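(* Let $M,I\subseteq[n]$ with $|M|=|I|$ and $n\in M\cap I$. There is an involution $\psi:\mathfrak{S}_n(M,I)\to\mathfrak{S}_n(M,I)$ such that for all $\pi\in\mathfrak{S}_n(M,I)$, $$\big(\mathrm{ca}(\pi),\mathrm{ci}(\pi)\big)=\big(\mathrm{ci}(\psi(\pi)),\mathrm{ca}(\psi(\pi))\big),$$ and moreover $|A^-(\psi(\pi))|=|A^-(\pi)|$.
   Context: For $\pi\in\mathfrak{S}_n$, a right-to-left maximum is a position $j$ with $\pi(j)>\pi(i)$ for all $i>j$. $\mathfrak{S}_n(M,I)$ is the set of $\pi\in\mathfrak{S}_n$ whose right-to-left maxima occur exactly at the positions in $I$ and whose right-to-left maximum values form exactly the set $M$. For values $x,y$ of $\pi$: $I^+(\pi)$ is the set of pairs $(y,x)$ with $y$ left of $x$, $y>x$, and some value $z>y$ to the right of $x$; $A^+(\pi)$ is the set of pairs $(x,y)$ with $x$ left of $y$, $x<y$, and some value $z>y$ to the right of $y$; $A^-(\pi)$ is the set of pairs $(x,y)$ with $x$ left of $y$, $x<y$, and no value larger than $y$ to the right of $y$. Functions $\mathrm{ci}(\pi),\mathrm{ca}(\pi):[n]\setminus M\to[n-1]$ are $\mathrm{ci}(\pi)(y)=|\{x:(y,x)\in I^+(\pi)\}|$ and $\mathrm{ca}(\pi)(y)=|\{x:(x,y)\in A^+(\pi)\}|$. *)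

(* Defs.v *)
From mathcomp Require Import all_boot all_fingroup.
Set Implicit Arguments.
Unset Strict Implicit.
Unset Printing Implicit Defensive.

(* Permutations of [n] are elements of 'S_n, acting on the 0-based set
   'I_n = {0, ..., n - 1} of both positions and values: [pi i] is the value at
   position [i] and [pos pi x] the position of the value [x]. *)

Section RightToLeftMaxima.

Variable n : nat.
Implicit Types (pi : 'S_n) (M I : {set 'I_n}) (x y z i j : 'I_n).

Definition pos pi x : 'I_n := (pi^-1)%g x.

Definition left_of pi x y : bool := pos pi x < pos pi y.

Definition rlmax_pos pi : {set 'I_n} :=
  [set j : 'I_n | [forall i : 'I_n, (j < i) ==> (pi i < pi j)]].

Definition rlmax_val pi : {set 'I_n} := [set pi j | j in rlmax_pos pi].

Definition perms_rlmax M I : {set 'S_n} :=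
  [set pi | (rlmax_pos pi == I) && (rlmax_val pi == M)].

Definition Iplus pi : {set 'I_n * 'I_n} :=
  [set yx : 'I_n * 'I_n | [&& left_of pi yx.1 yx.2, yx.2 < yx.1 &
    [exists z : 'I_n, (yx.1 < z) && left_of pi yx.2 z]]].

Definition Aplus pi : {set 'I_n * 'I_n} :=
  [set xy : 'I_n * 'I_n | [&& left_of pi xy.1 xy.2, xy.1 < xy.2 &
    [exists z : 'I_n, (xy.2 < z) && left_of pi xy.2 z]]].

Definition Aminus pi : {set 'I_n * 'I_n} :=
  [set xy : 'I_n * 'I_n | [&& left_of pi xy.1 xy.2, xy.1 < xy.2 &
    ~~ [exists z : 'I_n, (xy.2 < z) && left_of pi xy.2 z]]].

(* The domain is the complement of M, as a type. The counts may be 0, so the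
   functions are given values in nat; equality does not depend on this choice. *)
Definition ci M pi : {ffun {y : 'I_n | y \notin M} -> nat} :=
  [ffun y => #|[set x | (val y, x) \in Iplus pi]|].

Definition ca M pi : {ffun {y : 'I_n | y \notin M} -> nat} :=
  [ffun y => #|[set x | (x, val y) \in Aplus pi]|].

End RightToLeftMaxima.

(* Main.v *)
Require Import Defs.
From mathcomp Require Import all_boot all_fingroup zify.

(** Let [lehmer pi y] be the number of values smaller than [y] on the right of
    [y], and let [ntail pi k] be the number of positions to the right of all
    the values [>= k]. The code [lehmer] is a bijection onto the functions
    bounded by the identity. A value [y] is a right-to-left maximum iff
    [lehmer pi y < ntail pi y.+1], and [ntail] satisfies the recursion
    [ntail pi y = minn (lehmer pi y) (ntail pi y.+1)], so [M], [I] and [ntail]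
    can be read off the code. For [y \notin M] one has [ca y = y - lehmer pi y]
    and [ci y = lehmer pi y - ntail pi y.+1]; hence reflecting [lehmer pi y] in
    the interval [[ntail pi y.+1, y]] for all [y \notin M] exchanges [ca] and
    [ci], and it changes neither [ntail] nor the code on [M], which determines
    [I] and the cardinal of [Aminus]. *)

Set Implicit Arguments.
Unset Strict Implicit.
Unset Printing Implicit Defensive.

Section Code.

Variable n : nat.
Implicit Types (pi sigma : 'S_n) (M I : {set 'I_n}) (x y z : 'I_n).

Lemma pos_inj pi : injective (pos pi).
Proof. exact: perm_inj. Qed.

Lemma left_ofNge pi x y : x != y -> left_of pi x y = ~~ left_of pi y x.
Proof.
move=> neq; rewrite /left_of -leqNgt ltn_neqAle.
by rewrite (inj_eq val_inj) (inj_eq (@pos_inj pi)) neq.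
Qed.

Lemma left_of_trans pi y x z :
  left_of pi x y -> left_of pi y z -> left_of pi x z.
Proof. exact: ltn_trans. Qed.

Lemma left_of_irr pi x : left_of pi x x = false.
Proof. exact: ltnn. Qed.

(** * The code and its bijectivity *)

Definition smaller_right pi y : {set 'I_n} :=
  [set x : 'I_n | (x < y) && left_of pi y x].

Definition lehmer pi y := #|smaller_right pi y|.

Lemma card_ord_lt y : #|[set x : 'I_n | x < y]| = y.
Proof.
have widen_inj : injective (widen_ord (ltnW (ltn_ord y))).
  by move=> i j /(congr1 val) /= /val_inj.
rewrite -[RHS]card_ord -(card_imset _ widen_inj).
apply: eq_card => x; rewrite inE; apply/idP/imsetP => [lt_xy|[i _ ->]].
  by exists (Ordinal lt_xy) => //; apply: val_inj.
exact: ltn_ord i.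
Qed.

Lemma lehmer_leq pi y : lehmer pi y <= y.
Proof.
rewrite -[leqRHS]card_ord_lt; apply/subset_leq_card/subsetP => x.
by rewrite !inE => /andP[].
Qed.

Lemma card_smaller_left pi y :
  #|[set x : 'I_n | (x < y) && left_of pi x y]| = y - lehmer pi y.
Proof.
have sub : smaller_right pi y \subset [set x : 'I_n | x < y].
  by apply/subsetP => x; rewrite !inE => /andP[].
rewrite -{2}(card_ord_lt y) /lehmer -(setIidPr sub) -cardsD.
apply: eq_card => x; rewrite !inE; case: (ltnP x y) => //= lt_xy.
  by rewrite andbT left_ofNge // -(inj_eq val_inj) neq_ltn lt_xy.
Qed.

(* The two sets are up-closed for the same linear order on the values below
   [y], hence nested, hence equal when they have the same cardinal. *)
Lemma smaller_right_eq pi sigma y :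
    {in [pred x : 'I_n | x < y] &, left_of pi =2 left_of sigma} ->
    lehmer pi y = lehmer sigma y ->
  smaller_right pi y = smaller_right sigma y.
Proof.
move=> eqL eqc; apply/eqP.
have [sub|/subsetPn[a]] := boolP (smaller_right pi y \subset smaller_right sigma y).
  by rewrite eqEcard sub /=; move: eqc; rewrite /lehmer => ->.
have [sub|/subsetPn[b]] := boolP (smaller_right sigma y \subset smaller_right pi y).
  by rewrite eq_sym eqEcard sub /=; move: eqc; rewrite /lehmer => ->.
rewrite !inE => /andP[lb sb] nb /andP[la sa] na.
rewrite lb /= in nb; rewrite la /= in na.
have nby : b != y by rewrite -(inj_eq val_inj) neq_ltn lb.
have nay : a != y by rewrite -(inj_eq val_inj) neq_ltn la.
rewrite -left_ofNge // in nb; rewrite -left_ofNge // in na.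
have h1 := left_of_trans nb sa; have h2 := left_of_trans na sb.
have := left_of_trans h1 (etrans (eqL _ _ la lb) h2).
by rewrite left_of_irr.
Qed.

(** By induction on [k] the code determines the relative order of the values below [k]: each new
    value is inserted into an order already known, at the place given by its code. *)
Lemma lehmer_inj pi sigma : lehmer pi =1 lehmer sigma -> pi = sigma.
Proof.
move=> eqc.
have agree k : {in [pred x : 'I_n | x < k] &, left_of pi =2 left_of sigma}.
  elim: k => [|k IHk] x y //; rewrite !inE !ltnS.
  have step x' y' : x' < y' -> y' <= k ->
      left_of pi y' x' = left_of sigma y' x'.
    move=> lt_xy le_yk.
    have eqS : smaller_right pi y' = smaller_right sigma y'.
      apply: smaller_right_eq => // a b; rewrite !inE => la lb.
      by apply: IHk; rewrite inE; lia.
    by move/setP/(_ x'): eqS; rewrite !inE lt_xy.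
  move=> le_xk le_yk; case: (ltngtP x y) => [lt_xy|lt_yx|/val_inj->].
  - have nxy : x != y by rewrite -(inj_eq val_inj) neq_ltn lt_xy.
    by rewrite (left_ofNge pi nxy) (left_ofNge sigma nxy) step.
  - exact: step.
  - by rewrite !left_of_irr.
(* Positions start at 0, so a position is the number of values to its left; the relative order thus
   fixes the permutation. *)
have posE rho x : val (pos rho x) = #|[set y | left_of rho y x]|.
  rewrite -[LHS]card_ord_lt -(card_preimset _ (@pos_inj rho)).
  by apply: eq_card => y; rewrite !inE.
apply: invg_inj; apply/permP => x; apply: val_inj.
rewrite -/(pos pi x) -/(pos sigma x) !posE; apply: eq_card => y.
by rewrite !inE (agree n) // inE.
Qed.

(** By counting: [lehmer] is injective and there are [n!] codes. The boolean [forall] allows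
    [xchoose] in [flip]. *)
Lemma lehmer_surj (f : 'I_n -> nat) :
  (forall y, f y <= y) -> exists pi, [forall y, lehmer pi y == f y].
Proof.
move=> f_le.
pose code pi : {dffun forall y : 'I_n, 'I_y.+1} :=
  [ffun y => Ordinal (lehmer_leq pi y : _ < _.+1)].
have code_inj : injective code.
  move=> pi sigma /ffunP eqc; apply: lehmer_inj => y.
  by have /(congr1 val) := eqc y; rewrite !ffunE.
have card_codes : #|{dffun forall y : 'I_n, 'I_y.+1}| <= #|{perm 'I_n}|.
  (* Both sides are the product of the [y.+1] for [y < n]. *)
  rewrite card_dep_ffun card_Sn fact_prod big_add1 big_mkord.
  by rewrite foldrE big_image; apply/eq_leq/eq_bigr => y _; rewrite card_ord.
have [g _ gK] := inj_card_bij code_inj card_codes.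
pose c : {dffun forall y : 'I_n, 'I_y.+1} :=
  [ffun y => Ordinal (f_le y : _ < _.+1)].
exists (g c); apply/forallP => y; apply/eqP.
by have /ffunP/(_ y)/(congr1 val) := gK c; rewrite !ffunE.
Qed.

(** * Tails to the right of all large values *)

Definition tail pi (k : nat) : {set 'I_n} :=
  [set x : 'I_n | [forall z : 'I_n, (k <= z) ==> left_of pi z x]].

Definition ntail pi k := #|tail pi k|.

Lemma tailP pi k x :
  reflect (forall z : 'I_n, k <= z -> left_of pi z x) (x \in tail pi k).
Proof. by rewrite inE; apply: (iffP forall_inP). Qed.

(** Vacuous, and the base of the downward induction in [ntail_flip]. The index of [tail] is a
    natural number because [y.+1] can equal [n]. *)
Lemma tail_full pi : tail pi n = setT.
Proof.
by apply/setP => x; rewrite in_setT; apply/tailP => z; rewrite leqNgt ltn_ord.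
Qed.

Lemma tail_lt pi k x : x \in tail pi k -> x < k.
Proof. by move/tailP => tx; rewrite ltnNge; apply/negP => /tx; rewrite left_of_irr. Qed.

Lemma tail_right pi k x y : x \in tail pi k -> left_of pi x y -> y \in tail pi k.
Proof.
by move/tailP => tx lxy; apply/tailP => z /tx lzx; apply: left_of_trans lxy.
Qed.

(** A tail is closed to the right, so a value outside it lies to the left of all its elements. *)
Lemma tail_sub pi y :
  y \notin tail pi y.+1 -> tail pi y.+1 \subset smaller_right pi y.
Proof.
move=> ny; apply/subsetP => x tx.
have neq : y != x by apply: contraNneq ny => {1}->.
rewrite inE; have := tail_lt tx; rewrite ltnS leq_eqVlt.
rewrite (inj_eq val_inj) eq_sym (negPf neq) /= => ->.
by rewrite left_ofNge //; apply: contra ny; apply: tail_right.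
Qed.

Lemma smaller_rightE pi y : y \in tail pi y.+1 ->
  smaller_right pi y = [set x | left_of pi y x].
Proof.
move=> ty; apply/setP => x; rewrite !inE andb_idl // => lyx.
have := tail_lt (tail_right ty lyx).
rewrite ltnS leq_eqVlt => /orP[/eqP/val_inj exy|//].
by rewrite exy left_of_irr in lyx.
Qed.

(** The two sets counted are nested: if [y] is in the tail, then [smaller_right pi y] is a subset of
    the tail that misses [y]; otherwise [tail_sub] gives the reverse inclusion. *)
Lemma mem_tail_ntail pi y : (y \in tail pi y.+1) = (lehmer pi y < ntail pi y.+1).
Proof.
case: (boolP (y \in tail _ _)) => [ty|/tail_sub/subset_leq_card]; last first.
  by rewrite leqNgt => /negPf.
apply/esym/proper_card/properP; split.
  by rewrite smaller_rightE //; apply/subsetP => x; rewrite inE; apply: tail_right.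
by exists y => //; rewrite inE ltnn.
Qed.

Lemma ntail_rec pi y : ntail pi y = minn (lehmer pi y) (ntail pi y.+1).
Proof.
have tailE : tail pi y = tail pi y.+1 :&: [set x | left_of pi y x].
  apply/setP => x; rewrite in_setI (in_set (left_of pi y)).
  apply/tailP/andP => [tx|[/tailP tx lyx] z].
    by split; [apply/tailP => z /ltnW; apply: tx | apply: tx].
  by rewrite leq_eqVlt => /orP[/eqP/val_inj<-|/tx].
(* The sets intersected in [tailE] are nested, in an order that depends on whether [y] is in the
   tail; the smaller one gives the minimum. *)
have := mem_tail_ntail pi y; case: ltnP => _ ty.
  rewrite /ntail tailE /lehmer smaller_rightE //.
  congr #|pred_of_set _|; apply/setIidPr/subsetP => x.
  by rewrite inE; apply: tail_right.
have {}ty := negbT ty; rewrite /ntail tailE.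
congr #|pred_of_set _|; apply/setIidPl/subsetP => x.
by move/(subsetP (tail_sub ty)); rewrite !inE => /andP[].
Qed.

(** * Right-to-left maxima read off the code *)

Lemma mem_rlmax_pos pi x : (pos pi x \in rlmax_pos pi) = (x \in tail pi x.+1).
Proof.
rewrite inE; apply/forall_inP/tailP => [h z lt_xz|h i lt_xi].
  have nzx : z != x by rewrite -(inj_eq val_inj) neq_ltn lt_xz orbT.
  rewrite left_ofNge //; apply/negP => /h.
  by rewrite /pos !permKV ltnNge (ltnW lt_xz).
have := h (pi i); rewrite /left_of /pos permK permKV => {}h.
rewrite ltnNge; apply/negP; rewrite leq_eqVlt => /orP[/eqP/val_inj e|/h].
  by move: lt_xi; rewrite /pos e permK ltnn.
by rewrite ltnNge ltnW.
Qed.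

Lemma mem_rlmax_val pi x : (x \in rlmax_val pi) = (lehmer pi x < ntail pi x.+1).
Proof.
rewrite -mem_tail_ntail -mem_rlmax_pos; apply/imsetP/idP => [[j jI ->]|xI].
  by rewrite /pos permK.
by exists (pos pi x) => //; rewrite /pos permKV.
Qed.

Lemma rlmax_posE pi : rlmax_pos pi = pos pi @: rlmax_val pi.
Proof.
rewrite /rlmax_val -imset_comp -[LHS]imset_id.
by apply: eq_imset => j /=; rewrite /pos permK.
Qed.

(** Everything to the right of a right-to-left maximum is smaller, so its code counts all the
    positions after it. *)
Lemma pos_rlmax pi y : y \in rlmax_val pi -> val (pos pi y) = n - (lehmer pi y).+1.
Proof.
rewrite mem_rlmax_val -mem_tail_ntail => ty.
have : #|[set x | left_of pi y x]| + (pos pi y).+1 = n.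
  rewrite -[RHS](card_ord n) -(cardC [set x | left_of pi y x]); congr addn.
  transitivity #|pos pi @^-1: [set i : 'I_n | i <= pos pi y]|; last first.
    by apply: eq_card => x; rewrite !inE /left_of -leqNgt.
  rewrite (card_preimset _ (@pos_inj pi)).
  have lt := ltn_ord (pos pi y).
  transitivity #|pos pi y |: [set i : 'I_n | i < pos pi y]|.
    by rewrite cardsU1 inE ltnn card_ord_lt.
  by apply: eq_card => i; rewrite !inE [i <= _]leq_eqVlt (inj_eq val_inj).
by rewrite /lehmer smaller_rightE // => h; apply: (canRL (addnK _));
  rewrite addnS -addSn addnC.
Qed.

(** * The three statistics in terms of the code *)

(** Used with [x = y] for [Aplus] and [Aminus], and with [x < y] for [Iplus]. *)
Lemma tail_exists pi y x : x <= y ->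
  [exists z : 'I_n, (y < z) && left_of pi x z] = (x \notin tail pi y.+1).
Proof.
move=> le_xy; rewrite inE negb_forall; apply: eq_existsb => z.
rewrite negb_imply; case: ltnP => //= lt_yz.
by rewrite left_ofNge // -(inj_eq val_inj) neq_ltn (leq_ltn_trans le_xy).
Qed.

Lemma ca_code pi M (y : {y : 'I_n | y \notin M}) : rlmax_val pi = M ->
  ca M pi y = val y - lehmer pi (val y).
Proof.
move=> eqM; rewrite ffunE -card_smaller_left; apply: eq_card => x.
rewrite !inE /= tail_exists // mem_tail_ntail -mem_rlmax_val eqM.
by rewrite (valP y) andbT andbC.
Qed.

(** The values counted by [ci] are those of [smaller_right pi y] outside the tail, which is
    contained in it. *)
Lemma ci_code pi M (y : {y : 'I_n | y \notin M}) : rlmax_val pi = M ->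
  ci M pi y = lehmer pi (val y) - ntail pi (val y).+1.
Proof.
move=> eqM; have ty : val y \notin tail pi (val y).+1.
  by rewrite mem_tail_ntail -mem_rlmax_val eqM (valP y).
rewrite ffunE /lehmer /ntail -[in RHS](setIidPr (tail_sub ty)) -cardsD.
apply: eq_card => x; rewrite in_setD !inE /=.
case: (ltnP x (val y)) => [/ltnW le|]; last by rewrite !andbF.
by rewrite tail_exists // andbC inE.
Qed.

Lemma card_Aminus pi :
  #|Aminus pi| = \sum_(y in rlmax_val pi) (y - lehmer pi y).
Proof.
rewrite -sum1_card (eq_bigl (fun u : 'I_n * 'I_n => (u.2 \in rlmax_val pi) &&
  ((u.1 < u.2) && left_of pi u.1 u.2))); last first.
  move=> [x y]; rewrite !inE /= tail_exists // negbK mem_tail_ntail.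
  by rewrite -mem_rlmax_val [RHS]andbC andbA [(x < y) && _]andbC.
rewrite big_mkcond -(pair_bigA _ (fun x y => if (y \in rlmax_val pi) &&
  ((x < y) && left_of pi x y) then 1 else 0)) exchange_big [RHS]big_mkcond /=.
apply: eq_bigr => y _; rewrite -big_mkcond; case: (y \in _) => /=.
  rewrite -card_smaller_left -sum1_card; apply: eq_bigl => x.
  by rewrite inE.
by rewrite big_pred0.
Qed.

(** * The reflection of the code *)

Definition flip_code pi y : nat :=
  if lehmer pi y < ntail pi y.+1 then lehmer pi y
  else y - lehmer pi y + ntail pi y.+1.

(** In the second branch [ntail pi y.+1 <= lehmer pi y <= y], so the subtraction is exact and the
    reflection stays in the interval. *)
Lemma flip_code_leq pi y : flip_code pi y <= y.
Proof. by rewrite /flip_code; have := lehmer_leq pi y; case: ltnP; lia. Qed.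

Definition flip pi : 'S_n := xchoose (lehmer_surj (flip_code_leq pi)).

Lemma lehmer_flip pi : lehmer (flip pi) =1 flip_code pi.
Proof.
by move=> y; have /forallP/(_ y)/eqP := xchooseP (lehmer_surj (flip_code_leq pi)).
Qed.

Lemma ntail_flip pi k : k <= n -> ntail (flip pi) k = ntail pi k.
Proof.
(* Downward induction on [k], as [ntail_rec] goes from [y.+1] to [y]. A reflected code stays at
   least [ntail pi y.+1], so the minimum is unchanged. *)
move=> le_kn; rewrite -(subKn le_kn).
elim: (n - k) (leq_subr k n) => [|m IHm] lt_mn.
  by rewrite subn0 /ntail !tail_full.
have lt : n - m.+1 < n by lia.
have {IHm} := IHm (ltnW lt_mn); rewrite (_ : n - m = (n - m.+1).+1); last by lia.
have := ntail_rec pi (Ordinal lt); have := ntail_rec (flip pi) (Ordinal lt).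
rewrite lehmer_flip /flip_code /= => -> -> ->.
have := lehmer_leq pi (Ordinal lt).
by case: (ltnP (lehmer _ _)) => /=; lia.
Qed.

Lemma lehmer_flip_lt pi y :
  (lehmer (flip pi) y < ntail pi y.+1) = (lehmer pi y < ntail pi y.+1).
Proof.
rewrite lehmer_flip /flip_code; have [//|ge] := ltnP (lehmer pi y).
by have := lehmer_leq pi y; lia.
Qed.

Lemma flipK : involutive flip.
Proof.
move=> pi; apply: lehmer_inj => y; rewrite lehmer_flip {1}/flip_code.
rewrite ntail_flip // lehmer_flip_lt lehmer_flip /flip_code.
by have := lehmer_leq pi y; case: (ltnP (lehmer pi y)) => // *; lia.
Qed.

Lemma rlmax_val_flip pi : rlmax_val (flip pi) = rlmax_val pi.
Proof.
by apply/setP => y; rewrite !mem_rlmax_val ntail_flip // lehmer_flip_lt.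
Qed.

Lemma lehmer_flip_rlmax pi y :
  y \in rlmax_val pi -> lehmer (flip pi) y = lehmer pi y.
Proof. by rewrite mem_rlmax_val lehmer_flip /flip_code => ->. Qed.

Lemma rlmax_pos_flip pi : rlmax_pos (flip pi) = rlmax_pos pi.
Proof.
rewrite !rlmax_posE rlmax_val_flip; apply: eq_in_imset => y yM.
by apply: val_inj; rewrite !pos_rlmax ?rlmax_val_flip ?lehmer_flip_rlmax.
Qed.

Lemma flip_perms_rlmax pi M I :
  pi \in perms_rlmax M I -> flip pi \in perms_rlmax M I.
Proof. by rewrite !inE rlmax_val_flip rlmax_pos_flip. Qed.

Lemma ca_flip pi M : rlmax_val pi = M -> ca M (flip pi) = ci M pi.
Proof.
move=> eqM; apply/ffunP => y; rewrite ca_code ?rlmax_val_flip // ci_code //.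
rewrite lehmer_flip /flip_code -mem_rlmax_val eqM (negPf (valP y)).
by rewrite subnDA subKn ?lehmer_leq.
Qed.

Lemma card_Aminus_flip pi : #|Aminus (flip pi)| = #|Aminus pi|.
Proof.
rewrite !card_Aminus rlmax_val_flip; apply: eq_bigr => y yM.
by rewrite lehmer_flip_rlmax.
Qed.

End Code.

Theorem mainTheorem7 (n : nat) (M I : {set 'I_n.+1}) (hMI : #|M| = #|I|)
    (hmax : ord_max \in M :&: I) :
  exists psi : {sigma : 'S_n.+1 | sigma \in perms_rlmax M I} ->
               {sigma : 'S_n.+1 | sigma \in perms_rlmax M I},
    involutive psi /\
    forall pi : {sigma : 'S_n.+1 | sigma \in perms_rlmax M I},
      (ca M (val pi), ci M (val pi)) =
        (ci M (val (psi pi)), ca M (val (psi pi))) /\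
      #|Aminus (val (psi pi))| = #|Aminus (val pi)|.
Proof.
exists (fun pi => Sub (flip (val pi)) (flip_perms_rlmax (valP pi))).
split=> [pi|pi]; first by apply: val_inj; rewrite !SubK flipK.
have /andP[_ /eqP eqM] : (rlmax_pos (val pi) == I) && (rlmax_val (val pi) == M).
  by have := valP pi; rewrite inE.
rewrite SubK card_Aminus_flip; split=> //.
(* The other equality is [ca_flip] applied to [flip (val pi)], since [flip] is an involution. *)
rewrite (ca_flip eqM) -{1}[val pi]flipK ca_flip //.
by rewrite rlmax_val_flip.
Qed.
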